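(* For all $n,m\in\mathbb{N}$, the assignment $[f]\mapsto\llbracket f\rrbracket$ is a well-defined bijection from the hom-set $\mathrm{Syn}(\mathcal{T}_{\mathrm{KL}\otimes})(n,m)$ onto the set of all $2^m\times 2^n$ stochastic matrices, and it is an isometry: for all terms $f,g:n\to m$, $d^{\mathrm{KL}\otimes}(f,g)=\mathrm{KL}_{\max}(\llbracket f\rrbracket,\llbracket g\rrbracket)$.
   Context: Let $\mathbb{B}=\{0,1\}$. $\mathsf{BStoch}^\otimes$ is the symmetric monoidal category whose objects are natural numbers, whose morphisms $n\to m$ are $2^m\times 2^n$ stochastic matrices, viewed as functions $A:\mathbb{B}^n\to\mathcal{D}(\mathbb{B}^m)$ (finitely supported probability distributions), with matrix-product composition and monoidal product the Kronecker product $(A\otimes B)(uu')=A(u)\otimes B(u')$. For distributions $\mu,\nu$ on a finite set, $\mathrm{KL}(\mu,\nu)=\sum_x \mu(x)\log\frac{\mu(x)}{\nu(x)}$ with conventions $\log\frac{a}{0}=\infty$, $0\cdot\infty=0$. For $A,B:n\to m$, $\mathrm{KL}_{\max}(A,B)=\max_{u\in\mathbb{B}^n}\mathrm{KL}(A(u),B(u))$. Write $\mathrm{kl}(p,q)=p\log\frac pq+(1-p)\log\frac{1-p}{1-q}$. $\Sigma_{\mathrm{Circ}}$ is the monoidal signature with a single sort and generators discard $1\to 0$, copy $1\to 2$, and $2\to 1$, not $1\to1$, $\mathrm{flip}_p:0\to1$ ($p\in[0,1]$); terms are built with identities, symmetries, $;$ and $\otimes$, modulo the laws of symmetric strict monoidal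 categories. $\llbracket-\rrbracket$ is the symmetric monoidal functor into $\mathsf{BStoch}^\otimes$ with copy $b\mapsto\delta_{bb}$, and $(a,b)\mapsto\delta_{a\wedge b}$, not $b\mapsto\delta_{\neg b}$, $\mathrm{flip}_p\mapsto p\delta_1+(1-p)\delta_0$, discard the unique map to $\mathcal{D}(\mathbb{B}^0)$. $\mathcal{T}_{\mathrm{Circ}}$ is the monoidal theory of causal circuits of Piedeleu et al.: a fixed set of equations between $\Sigma_{\mathrm{Circ}}$-terms such that (known result) two terms are equal modulo the congruence generated by these equations and the monoidal laws iff they have the same interpretation, and every morphism of $\mathsf{BStoch}^\otimes$ is the interpretation of a term. $\mathrm{if}_n:1+n+n\to n$ is a fixed term with $\llbracket\mathrm{if}_n\rrbracket(x,u,v)=\delta_u$ if $x=1$, $\delta_v$ if $x=0$. For $f_1,f_0:0\to m$, $D_p(f_1,f_0)=(\mathrm{flip}_p\otimes f_1\otimes f_0);(\mathrm{copy}\otimes\mathrm{id}_m\otimes\mathrm{id}_m);(\mathrm{id}_1\otimes\mathrm{if}_m)$. The theory $\mathcal{T}_{\mathrm{KL}\otimes}$ over $\Sigma_{\mathrm{Circ}}$ has as axioms: every equation of $\mathcal{T}_{\mathrm{Circ}}$ (with no premises); $f=_0f$ for every term $f$; (Chain$_\otimes$) for all $f_1,g_1,f_0,g_0:0\to m$, $p,q\in[0,1]$, $\varepsilon,\delta\in[0,\infty]$: from $f_1=_\varepsilon g_1$ and $f_0=_\delta g_0$ infer $D_p(f_1,f_0)=_{\mathrm{kl}(p,q)+p\varepsilon+(1-p)\delta}D_q(g_1,g_0)$;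 (Ifmax) for all $f_1,g_1:n\to m$, $f_0,g_0:n'\to m$: from $f_1=_\varepsilon g_1$ and $f_0=_\delta g_0$ infer $(\mathrm{id}_1\otimes f_1\otimes f_0);\mathrm{if}_m=_{\max\{\varepsilon,\delta\}}(\mathrm{id}_1\otimes g_1\otimes g_0);\mathrm{if}_m$. Derivability ($\vdash$) means existence of a well-founded (possibly infinitely branching) proof tree with no open leaves using: the axioms; reflexivity, symmetry, transitivity of $=$ and its congruence with $;$ and $\otimes$; the monoidal laws as equations; replacement of a term by an equal one in either side of $f=_\varepsilon g$; monotonicity (from $f=_\varepsilon g$ infer $f=_{\varepsilon'}g$ for $\varepsilon\le\varepsilon'$); continuity (from $f=_{\varepsilon_i}g$ for all $i\in I$ infer $f=_{\inf_i\varepsilon_i}g$); nonexpansiveness (from $f=_\varepsilon f'$, $g=_\delta g'$ infer $f;g=_{\varepsilon+\delta}f';g'$ and $f\otimes g=_{\varepsilon+\delta}f'\otimes g'$). The syntactic category $\mathrm{Syn}(\mathcal{T}_{\mathrm{KL}\otimes})$ has hom-sets $\mathrm{Syn}(n,m)$ consisting of terms $n\to m$ modulo $f\equiv g\iff\ \vdash f=g$, with distance $d^{\mathrm{KL}\otimes}(f,g)=\inf\{\varepsilon\in[0,\infty]\mid\ \vdash f=_\varepsilon g\}$. *)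

(* Defs.v *)
From HB Require Import structures.
From mathcomp Require Import all_boot all_order all_algebra.
From mathcomp Require Import interval_inference.
From mathcomp Require Import boolp classical_sets reals ereal exp.

Set Implicit Arguments.
Unset Strict Implicit.
Unset Printing Implicit Defensive.

Import Order.TTheory GRing.Theory Num.Theory.

Local Open Scope ring_scope.

Section Distributions.
Context {R : realType}.

Record dist (T : finType) := Dist {
  dist_fun :> {ffun T -> R};
  _ : [forall x, 0 <= dist_fun x] && (\sum_x dist_fun x == 1) }.

HB.instance Definition _ (T : finType) := [isSub for @dist_fun T].

Lemma dist_ge0 (T : finType) (mu : dist T) x : 0 <= mu x.
Proof. by case: mu => f /= /andP[/forallP]. Qed.

Lemma dist_sum1 (T : finType) (mu : dist T) : \sum_x mu x = 1.
Proof. by case: mu => f /= /andP[_ /eqP]. Qed.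

Lemma dist_ext (T : finType) (mu nu : dist T) : mu =1 nu -> mu = nu.
Proof. by move=> e; apply/val_inj/ffunP. Qed.

Lemma dirac_subproof (T : finType) (x : T) :
  let f := [ffun y => (y == x)%:R : R] in
  [forall y, 0 <= f y] && (\sum_y f y == 1).
Proof.
apply/andP; split; first by apply/forallP => y; rewrite ffunE ler0n.
rewrite (bigD1 x) //= ffunE eqxx big1 ?addr0// => y /negPf yx.
by rewrite ffunE yx.
Qed.
Definition dirac (T : finType) (x : T) : dist T := Dist (dirac_subproof x).

Lemma bind_subproof (T U : finType) (mu : dist T) (k : T -> dist U) :
  let f := [ffun y => \sum_x mu x * k x y] in
  [forall y, 0 <= f y] && (\sum_y f y == 1).
Proof.
apply/andP; split.
  apply/forallP => y; rewrite ffunE sumr_ge0// => x _.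
  by rewrite mulr_ge0 ?dist_ge0.
under eq_bigr do rewrite ffunE.
rewrite exchange_big /=.
under eq_bigr do rewrite -big_distrr /= dist_sum1 mulr1.
by rewrite dist_sum1.
Qed.
Definition bind (T U : finType) (mu : dist T) (k : T -> dist U) : dist U :=
  Dist (bind_subproof mu k).

End Distributions.
Arguments dist : clear implicits.

Notation bits n := (n.-tuple bool).

Section Bits.
Variables n m : nat.

Definition bfst (w : bits (n + m)) : bits n :=
  [tuple tnth w (lshift m i) | i < n].

Definition bsnd (w : bits (n + m)) : bits m :=
  [tuple tnth w (rshift n i) | i < m].

Definition bcat (u : bits n) (v : bits m) : bits (n + m) := cat_tuple u v.

Lemma bfst_cat u v : bfst (bcat u v) = u.
Proof. by apply: eq_from_tnth => i; rewrite tnth_mktuple tnth_lshift. Qed.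

Lemma bsnd_cat u v : bsnd (bcat u v) = v.
Proof. by apply: eq_from_tnth => i; rewrite tnth_mktuple tnth_rshift. Qed.

Lemma bcatK w : bcat (bfst w) (bsnd w) = w.
Proof.
apply: eq_from_tnth => i; rewrite -(splitK i).
by case: (split i) => j /=; rewrite (tnth_lshift, tnth_rshift) tnth_mktuple.
Qed.

End Bits.

Section Kronecker.
Context {R : realType}.

Lemma kron_subproof n m (mu : dist R (bits n)) (nu : dist R (bits m)) :
  let f := [ffun w : bits (n + m) => mu (bfst w) * nu (bsnd w)] in
  [forall w, 0 <= f w] && (\sum_w f w == 1).
Proof.
apply/andP; split.
  by apply/forallP => w; rewrite ffunE mulr_ge0 ?dist_ge0.
rewrite (reindex (fun p => bcat p.1 p.2)) /=; last first.
  exists (fun w => (bfst w, bsnd w)) => [[u v] _|w _] /=.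
    by rewrite bfst_cat bsnd_cat.
  by rewrite bcatK.
under eq_bigr do rewrite ffunE bfst_cat bsnd_cat.
rewrite -(pair_bigA _ (fun u v => mu u * nu v)) /=.
under eq_bigr do rewrite -big_distrr /= dist_sum1 mulr1.
by rewrite dist_sum1.
Qed.
Definition kron n m (mu : dist R (bits n)) (nu : dist R (bits m)) :
  dist R (bits (n + m)) := Dist (kron_subproof mu nu).

Lemma bernoulli_subproof (p : {i01 R}) :
  let f := [ffun x : bits 1 => p%:num * (x == [tuple true])%:R
                               + (1 - p%:num) * (x == [tuple false])%:R] in
  [forall x, 0 <= f x] && (\sum_x f x == 1).
Proof.
apply/andP; split.
  apply/forallP => x; rewrite ffunE.
  by rewrite addr_ge0 ?mulr_ge0 ?ler0n ?subr_ge0.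
under eq_bigr do rewrite ffunE.
rewrite big_split /= -!big_distrr /=.
have s (b : bits 1) : \sum_x (x == b)%:R = 1 :> R.
  rewrite (bigD1 b) //= eqxx big1 ?addr0// => x /negPf ->//.
by rewrite !s !mulr1 addrC subrK.
Qed.
Definition bernoulli (p : {i01 R}) : dist R (bits 1) :=
  Dist (bernoulli_subproof p).

End Kronecker.

(* [A u v] is the entry in row v and column u of the 2^m x 2^n matrix A: the
   columns, not the rows, are the distributions. *)
Notation stoch R n m := {ffun bits n -> dist R (bits m)}.

Section Stoch.
Context {R : realType}.

Definition stoch_of n m (h : bits n -> bits m) : stoch R n m :=
  [ffun u => dirac (h u)].

Definition stoch_comp n m k (A : stoch R n m) (B : stoch R m k) :
  stoch R n k := [ffun u => bind (A u) B].

Definition stoch_tens n m n' m' (A : stoch R n m) (B : stoch R n' m') :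
  stoch R (n + n') (m + m') := [ffun w => kron (A (bfst w)) (B (bsnd w))].

End Stoch.

Section Divergence.
Context {R : realType}.
Local Open Scope ereal_scope.

(* The value of [ln (0 / b)] is irrelevant: in [kl_summand] it is multiplied
   by 0; likewise [0 * +oo = 0] in [\bar R]. *)
Definition log_ratio (a b : R) : \bar R :=
  if b == 0%R then +oo else (ln (a / b))%:E.

Definition kl_summand (a b : R) : \bar R := a%:E * log_ratio a b.

Definition KL (T : finType) (mu nu : dist R T) : \bar R :=
  \sum_x kl_summand (mu x) (nu x).

Definition KLmax n m (A B : stoch R n m) : \bar R :=
  \big[maxe/-oo]_(u : bits n) KL (A u) (B u).

Definition kl (p q : {i01 R}) : \bar R :=
  kl_summand p%:num q%:num + kl_summand (1 - p%:num) (1 - q%:num).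

End Divergence.

Inductive term (R : realType) : nat -> nat -> Type :=
| Discard : term R 1 0
| Copy : term R 1 2
| And : term R 2 1
| Not : term R 1 1
| Flip of {i01 R} : term R 0 1
| Id n : term R n n
| Sym n m : term R (n + m) (m + n)
| Comp n m k of term R n m & term R m k : term R n k
| Tens n m n' m' of term R n m & term R n' m' : term R (n + n') (m + m').

Arguments Discard {R}.
Arguments Copy {R}.
Arguments And {R}.
Arguments Not {R}.
Arguments Id {R}.
Arguments Sym {R}.

Declare Scope circ_scope.
Delimit Scope circ_scope with circ.
Bind Scope circ_scope with term.
Notation "f ;; g" := (Comp f g) (at level 50, left associativity) : circ_scope.
Notation "f ⊗ g" := (Tens f g) (at level 40, left associativity) : circ_scope.
Local Open Scope circ_scope.

Section Interpretation.
Context {R : realType}.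

Fixpoint interp n m (f : term R n m) : stoch R n m :=
  match f in term _ n m return stoch R n m with
  | Discard => stoch_of (fun=> [tuple])
  | Copy => stoch_of (fun u => [tuple thead u; thead u])
  | And => stoch_of (fun u => [tuple tnth u ord0 && tnth u ord_max])
  | Not => stoch_of (fun u => [tuple ~~ thead u])
  | Flip p => [ffun=> bernoulli p]
  | Id n => stoch_of id
  | Sym n m => stoch_of (fun w => bcat (bsnd w) (bfst w))
  | Comp _ _ _ f g => stoch_comp (interp f) (interp g)
  | Tens _ _ _ _ f g => stoch_tens (interp f) (interp g)
  end.

(* Needed because, e.g., [n + 0] and [n] are not convertible. *)
Definition castt n n' m m' (en : n = n') (em : m = m') (f : term R n m) :
  term R n' m' := ecast a (term R a m') en (ecast b (term R n b) em f).

End Interpretation.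

Inductive smc_law (R : realType) :
  forall n m, term R n m -> term R n m -> Prop :=
| smc_compA n m k l (f : term R n m) (g : term R m k) (h : term R k l) :
    smc_law (f ;; g ;; h) (f ;; (g ;; h))
| smc_comp1l n m (f : term R n m) : smc_law (Id n ;; f) f
| smc_comp1r n m (f : term R n m) : smc_law (f ;; Id m) f
| smc_tens_id n m : smc_law (Id n ⊗ Id m) (Id (n + m))
| smc_interchange n m k n' m' k' (f : term R n m) (g : term R m k)
    (f' : term R n' m') (g' : term R m' k') :
    smc_law ((f ;; g) ⊗ (f' ;; g')) (f ⊗ f' ;; g ⊗ g')
| smc_tensA n1 m1 n2 m2 n3 m3
    (f : term R n1 m1) (g : term R n2 m2) (h : term R n3 m3) :
    smc_law (castt (addnA n1 n2 n3) (addnA m1 m2 m3) (f ⊗ (g ⊗ h)))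
            (f ⊗ g ⊗ h)
| smc_tens1l n m (f : term R n m) : @smc_law R n m (Id 0 ⊗ f) f
| smc_tens1r n m (f : term R n m) :
    smc_law (castt (addn0 n) (addn0 m) (f ⊗ Id 0)) f
| smc_sym_nat n m n' m' (f : term R n m) (f' : term R n' m') :
    smc_law (f ⊗ f' ;; Sym m m') (Sym n n' ;; f' ⊗ f)
| smc_symK n m : smc_law (Sym n m ;; Sym m n) (Id (n + m))
| smc_sym_unit n : smc_law (castt (addn0 n) erefl (Sym n 0)) (Id n)
| smc_hexagon n m k :
    smc_law (Sym n (m + k))
      (castt (esym (addnA n m k)) (esym (addnA m n k)) (Sym n m ⊗ Id k) ;;
       castt erefl (addnA m k n) (Id m ⊗ Sym n k)).

Definition equations (R : realType) :=
  forall n m, term R n m -> term R n m -> Prop.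

(* The congruence generated by [E] and the laws of symmetric strict monoidal
   categories. *)
Inductive eq_deriv (R : realType) (E : equations R) :
  forall n m, term R n m -> term R n m -> Prop :=
| eq_ax n m (f g : term R n m) : E n m f g -> eq_deriv E f g
| eq_smc n m (f g : term R n m) : smc_law f g -> eq_deriv E f g
| eq_refl n m (f : term R n m) : eq_deriv E f f
| eq_sym n m (f g : term R n m) : eq_deriv E f g -> eq_deriv E g f
| eq_trans n m (f g h : term R n m) :
    eq_deriv E f g -> eq_deriv E g h -> eq_deriv E f h
| eq_comp n m k (f f' : term R n m) (g g' : term R m k) :
    eq_deriv E f f' -> eq_deriv E g g' -> eq_deriv E (f ;; g) (f' ;; g')
| eq_tens n m n' m' (f f' : term R n m) (g g' : term R n' m') :
    eq_deriv E f f' -> eq_deriv E g g' -> eq_deriv E (f ⊗ g) (f' ⊗ g').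

Section Theory.
Context {R : realType}.

Definition branch (if_ : forall n, term R (1 + n + n) n)
    (p : {i01 R}) m (f1 f0 : term R 0 m) : term R 0 (1 + m) :=
  (Flip p ⊗ f1 ⊗ f0) ;; (Copy ⊗ Id m ⊗ Id m) ;; (Id 1 ⊗ if_ m).

Definition ifthenelse (if_ : forall n, term R (1 + n + n) n)
    n n' m (f1 : term R n m) (f0 : term R n' m) : term R (1 + n + n') m :=
  (Id 1 ⊗ f1 ⊗ f0) ;; if_ m.

(* [eq_deriv] and [q_deriv] are the two forms of derivable judgement: since
   no rule infers an equation [f = g] from a distance judgement, derivability
   of equations is defined first. Distances range over [0, +oo], hence the
   nonnegativity premises; [q_refl], [q_chain] and [q_ifmax]
   are the quantitative axioms of the theory, the other constructors are the
   deduction rules. *)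
Inductive q_deriv (E : equations R) (if_ : forall n, term R (1 + n + n) n) :
  forall n m, term R n m -> term R n m -> \bar R -> Prop :=
| q_refl n m (f : term R n m) : q_deriv E if_ f f 0%E
| q_chain m (f1 g1 f0 g0 : term R 0 m) (p q : {i01 R}) (e d : \bar R) :
    (0 <= e)%E -> (0 <= d)%E ->
    q_deriv E if_ f1 g1 e -> q_deriv E if_ f0 g0 d ->
    q_deriv E if_ (branch if_ p f1 f0) (branch if_ q g1 g0)
      (kl p q + p%:num%:E * e + (1 - p%:num)%:E * d)%E
| q_ifmax n n' m (f1 g1 : term R n m) (f0 g0 : term R n' m) (e d : \bar R) :
    (0 <= e)%E -> (0 <= d)%E ->
    q_deriv E if_ f1 g1 e -> q_deriv E if_ f0 g0 d ->
    q_deriv E if_ (ifthenelse if_ f1 f0) (ifthenelse if_ g1 g0) (maxe e d)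
| q_replace n m (f f' g g' : term R n m) (e : \bar R) :
    eq_deriv E f f' -> eq_deriv E g g' ->
    q_deriv E if_ f g e -> q_deriv E if_ f' g' e
| q_mono n m (f g : term R n m) (e e' : \bar R) :
    (0 <= e)%E -> (e <= e')%E ->
    q_deriv E if_ f g e -> q_deriv E if_ f g e'
| q_cont n m (f g : term R n m) (I : Type) (e : I -> \bar R) :
    (forall i, 0 <= e i)%E -> (forall i, q_deriv E if_ f g (e i)) ->
    q_deriv E if_ f g (ereal_inf (range e))
| q_comp n m k (f f' : term R n m) (g g' : term R m k) (e d : \bar R) :
    (0 <= e)%E -> (0 <= d)%E ->
    q_deriv E if_ f f' e -> q_deriv E if_ g g' d ->
    q_deriv E if_ (f ;; g) (f' ;; g') (e + d)%E
| q_tens n m n' m' (f f' : term R n m) (g g' : term R n' m') (e d : \bar R) :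
    (0 <= e)%E -> (0 <= d)%E ->
    q_deriv E if_ f f' e -> q_deriv E if_ g g' d ->
    q_deriv E if_ (f ⊗ g) (f' ⊗ g') (e + d)%E.

Definition dKL (E : equations R) (if_ : forall n, term R (1 + n + n) n)
    n m (f g : term R n m) : \bar R :=
  ereal_inf [set e | (0 <= e)%E /\ q_deriv E if_ f g e]%classic.

End Theory.

HB.instance Definition _ (R : realType) n m := gen_eqMixin (term R n m).
HB.instance Definition _ (R : realType) n m := gen_choiceMixin (term R n m).

Section Syn.
Context {R : realType} (E : equations R).
Local Open Scope quotient_scope.

Definition syn_eq n m (f g : term R n m) : bool := `[< eq_deriv E f g >].

Lemma syn_eq_class n m : equiv_class_of (@syn_eq n m).
Proof.
split=> [f|f g|g f h] /=.
- exact/asboolP/eq_refl.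
- by apply/asboolP/asboolP; exact: eq_sym.
- by move=> /asboolP fg /asboolP gh; apply/asboolP/(eq_trans fg gh).
Qed.

Canonical syn_eq_equiv n m := EquivRelPack (@syn_eq_class n m).

Definition Syn n m : Type := {eq_quot @syn_eq n m}.

Definition syn_class n m (f : term R n m) : Syn n m :=
  \pi_({eq_quot @syn_eq n m}) f.

End Syn.

(* Main.v *)
(** Soundness is the chain rule for the divergence: the summand
    [a * ln (a / b)] is subadditive (log-sum inequality) and satisfies a
    Leibniz rule on products, which together give
    [KL (bind mu k) (bind nu l) <= KL mu nu + sup_x KL (k x) (l x)], with
    equality for [D_p], whose outcome determines which branch was taken.
    Completeness and universality use the same recursion: a distribution on
    [1 + m] bits is a [D_p] of two distributions on [m] bits, and a matrix
    with [1 + n] inputs is a conditional on its first input bit. Along this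
    recursion the rules (Chain) and (Ifmax) compute exactly the divergence. *)
Require Import Defs.
From mathcomp Require Import all_boot all_order all_algebra.
From mathcomp Require Import interval_inference.
From mathcomp Require Import boolp classical_sets reals ereal exp.
From mathcomp Require Import ring lra.

Set Implicit Arguments.
Unset Strict Implicit.
Unset Printing Implicit Defensive.

Import Order.TTheory GRing.Theory Num.Theory.

(** * Pointwise estimates: log-sum inequality and Leibniz rule *)

Section KLSummand.
Context {R : realType}.
Local Open Scope ring_scope.
Local Open Scope ereal_scope.
Implicit Types a b c d : R.

Lemma kl_summand_fin a b :
  b != 0%R -> kl_summand a b = (a * ln (a / b))%R%:E.
Proof. by rewrite /kl_summand /log_ratio => /negPf ->. Qed.

Lemma kl_summand_a0 a : (0 < a)%R -> kl_summand a 0%R = +oo.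
Proof. by move=> a0; rewrite /kl_summand /log_ratio eqxx gt0_muley ?lte_fin. Qed.

Lemma kl_summand_0b b : kl_summand 0%R b = 0.
Proof. by rewrite /kl_summand mul0e. Qed.

(** Keeps sums of summands clear of the indeterminate form [+oo + -oo], so that addition and
    distributivity in [\bar R] can be used safely. *)
Lemma kl_summand_Nny a b : (0 <= a)%R -> kl_summand a b != -oo.
Proof.
rewrite le_eqVlt => /predU1P[<-|a0]; first by rewrite kl_summand_0b.
by have [->|b0] := eqVneq b 0%R; [rewrite kl_summand_a0|rewrite kl_summand_fin].
Qed.

Lemma adde_def_Nny (x y : \bar R) : x != -oo -> y != -oo -> x +? y.
Proof. by rewrite /adde_def => /negPf -> /negPf ->; rewrite !andbF. Qed.

(* The tangent inequality [ln t <= t - 1] at [t = c * b / a]. *)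
Lemma le_mul_ln a b c : (0 <= a)%R -> (0 < b)%R -> (0 < c)%R ->
  (a * ln c + a - c * b <= a * ln (a / b))%R.
Proof.
rewrite le_eqVlt => /predU1P[<- b0 c0|a0 b0 c0].
  by rewrite !mul0r !add0r oppr_le0 mulr_ge0// ltW.
have t0 : (0 < c * b / a)%R by rewrite divr_gt0// mulr_gt0.
have := @le_ln1Dx R (c * b / a - 1).
rewrite ltrBrDl subrr t0 addrC subrK => /(_ isT) le_ln.
have lnE : (ln (c * b / a) = ln c - ln (a / b))%R.
  rewrite -ln_div ?posrE ?divr_gt0//; congr ln.
  by field; rewrite !gt_eqF.
rewrite lnE -(ler_pM2l a0) in le_ln.
have -> : (c * b = a * (c * b / a))%R by field; rewrite gt_eqF.
lra.
Qed.

(** The two-term log-sum inequality: apply [le_mul_ln] to both pairs with the common value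
    [c = (a + a') / (b + b')] and add. Zero denominators are handled separately. *)
Lemma kl_summandD a b a' b' :
  (0 <= a)%R -> (0 <= b)%R -> (0 <= a')%R -> (0 <= b')%R ->
  kl_summand (a + a') (b + b') <= kl_summand a b + kl_summand a' b'.
Proof.
(* One denominator is 0: either its numerator vanishes and both sides agree, or the right-hand side
   is [+oo]. *)
have oneb0 (x y y' : R) : (0 <= x)%R -> (0 <= y)%R -> (0 <= y')%R ->
    kl_summand (x + y) (0 + y') <= kl_summand x 0%R + kl_summand y y'.
  rewrite le_eqVlt => /predU1P[<- _ _|x0 y0 _].
    by rewrite kl_summand_0b !add0r.
  by rewrite kl_summand_a0// addye ?leey// kl_summand_Nny.
move=> a0; rewrite le_eqVlt => /predU1P[<- a'0 b'0|b0 a'0].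
  exact: oneb0.
rewrite le_eqVlt => /predU1P[<-|b'0].
  by rewrite addrC (addrC b) addeC oneb0// ltW.
rewrite !kl_summand_fin ?gt_eqF ?addr_gt0// -EFinD lee_fin.
(* If [a + a' = 0] then [c] would be 0, outside the range of the tangent inequality; but then both
   numerators vanish. *)
have := addr_ge0 a0 a'0; rewrite le_eqVlt => /predU1P[s0|s0].
  have /eqP := esym s0; rewrite paddr_eq0// => /andP[/eqP-> /eqP->].
  by rewrite !addr0 !mul0r addr0.
set c := ((a + a') / (b + b'))%R.
have c0 : (0 < c)%R by rewrite divr_gt0// addr_gt0.
have h := le_mul_ln a0 b0 c0; have h' := le_mul_ln a'0 b'0 c0.
(* The linear corrections cancel in total, because [c * (b + b') = a + a']. *)
have -> : ((a + a') * ln c = (a * ln c + a - c * b) + (a' * ln c + a' - c * b'))%R.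
  suff : (a + a' = c * (b + b'))%R by move=> e; lra.
  by rewrite /c mulfVK// gt_eqF// addr_gt0.
exact: lerD.
Qed.

(** The logarithm turns the product of ratios into a sum. With positive numerators and a zero
    denominator both sides are [+oo], since the other summand is never [-oo]. *)
Lemma kl_summandM a b c d :
  (0 <= a)%R -> (0 <= b)%R -> (0 <= c)%R -> (0 <= d)%R ->
  kl_summand (a * b) (c * d) = b%:E * kl_summand a c + a%:E * kl_summand b d.
Proof.
rewrite le_eqVlt => /predU1P[<- _ _ _|a0].
  by rewrite mul0r !kl_summand_0b mule0 mul0e adde0.
rewrite le_eqVlt => /predU1P[<- _ _|b0].
  by rewrite mulr0 !kl_summand_0b mul0e mule0 adde0.
rewrite le_eqVlt => /predU1P[<- _|c0].
  rewrite mul0r !kl_summand_a0 ?mulr_gt0// gt0_muley ?lte_fin// addye//.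
  have := kl_summand_Nny d (ltW b0); case: (kl_summand b d) => [r _|_|//].
    by rewrite -EFinM.
  by rewrite gt0_muley ?lte_fin.
rewrite le_eqVlt => /predU1P[<-|d0].
  rewrite mulr0 !kl_summand_a0 ?mulr_gt0// [kl_summand a c]kl_summand_fin ?gt_eqF//.
  by rewrite -EFinM gt0_muley ?lte_fin// addey.
rewrite !kl_summand_fin ?gt_eqF ?mulr_gt0// -!EFinM -EFinD; congr EFin.
have -> : (a * b / (c * d) = (a / c) * (b / d))%R.
  by field; rewrite !gt_eqF.
by rewrite lnM ?posrE ?divr_gt0//; ring.
Qed.

Lemma kl_summand_sum (I : Type) (r : seq I) (F G : I -> R) :
  (forall i, 0 <= F i)%R -> (forall i, 0 <= G i)%R ->
  kl_summand (\sum_(i <- r) F i)%R (\sum_(i <- r) G i)%R <=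
  \sum_(i <- r) kl_summand (F i) (G i).
Proof.
move=> F0 G0; elim: r => [|i r IH]; first by rewrite !big_nil kl_summand_0b.
rewrite !big_cons; apply: le_trans (leeD2l _ IH).
by apply: kl_summandD => //; exact: sumr_ge0.
Qed.

End KLSummand.

(** * Nonnegativity of the divergence and its growth under composition *)

Section Divergence.
Context {R : realType}.
Local Open Scope ring_scope.
Local Open Scope ereal_scope.

(** By the log-sum inequality the sum dominates the summand of the total masses,
    [1 * ln (1 / 1) = 0]. *)
Lemma KL_ge0 (T : finType) (mu nu : dist R T) : 0 <= KL mu nu.
Proof.
have := @kl_summand_sum R T (index_enum T) mu nu (dist_ge0 mu) (dist_ge0 nu).
by rewrite !dist_sum1 kl_summand_fin ?oner_eq0// divr1 ln1 mulr0.
Qed.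

Lemma kl_ge0 (p q : {i01 R}) : 0 <= kl p q.
Proof.
have p1 : (0 <= 1 - p%:num :> R)%R by rewrite subr_ge0.
have q1 : (0 <= 1 - q%:num :> R)%R by rewrite subr_ge0.
apply: le_trans (kl_summandD (ge0 p) (ge0 q) p1 q1).
by rewrite !(addrC _ (1 - _)%R) !subrK kl_summand_fin ?oner_eq0// divr1 ln1 mulr0.
Qed.

Lemma KLxx (T : finType) (mu : dist R T) : KL mu mu = 0.
Proof.
rewrite /KL big1// => x _; have [->|x0] := eqVneq (mu x) 0%R.
  by rewrite kl_summand_0b.
by rewrite kl_summand_fin// divff// ln1 mulr0.
Qed.

(** The Leibniz rule summed over [x]: the weights [mu x] of the first term add up to 1. It is the
    common source of the chain rules for [bind], [mixture] and [kron]. *)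
Lemma sum_kl_summandM (T : finType) (a b : R) (mu nu : dist R T) :
  (0 <= a)%R -> (0 <= b)%R ->
  \sum_x kl_summand (a * mu x) (b * nu x) = kl_summand a b + a%:E * KL mu nu.
Proof.
move=> a0 b0.
under eq_bigr do rewrite kl_summandM ?dist_ge0//.
rewrite big_split /=; congr (_ + _).
  under eq_bigr do rewrite muleC.
  (* The constant may be negative or [+oo], so pulling it out of the sum takes a different argument
     in each case. *)
  case e : (kl_summand a b) => [r| |].
  - by under eq_bigr do rewrite -EFinM; rewrite sumEFin -big_distrr /= dist_sum1 mulr1.
  - rewrite -ge0_sume_distrr => [|x _]; last by rewrite lee_fin dist_ge0.
    by rewrite sumEFin dist_sum1 mule1.
  - by have := kl_summand_Nny b a0; rewrite e.
rewrite fin_num_sume_distrr// => x y _ _.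
by rewrite adde_def_Nny ?kl_summand_Nny ?dist_ge0.
Qed.

(** Compare the joint laws of the pair [(x, y)] first: marginalising to [y] can only lower the
    divergence, by the log-sum inequality, and on joint laws the chain rule is exact. *)
Lemma KL_bind (T U : finType) (mu nu : dist R T) (k l : T -> dist R U) e :
  (forall x, KL (k x) (l x) <= e) ->
  KL (bind mu k) (bind nu l) <= KL mu nu + e.
Proof.
move=> kle.
apply: (@le_trans _ _ (\sum_y \sum_x kl_summand (mu x * k x y) (nu x * l x y))).
  apply: lee_sum => y _; rewrite !ffunE.
  by apply: kl_summand_sum => x; rewrite mulr_ge0 ?dist_ge0.
rewrite exchange_big /=.
under eq_bigr do rewrite sum_kl_summandM ?dist_ge0//.
rewrite big_split /=; apply: leeD2l.
apply: (@le_trans _ _ (\sum_x (mu x)%:E * e)).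
  by apply: lee_sum => x _; rewrite lee_wpmul2l ?lee_fin ?dist_ge0.
rewrite -ge0_sume_distrl => [|x _]; last by rewrite lee_fin dist_ge0.
by rewrite sumEFin dist_sum1 mul1e.
Qed.

Lemma KLmax_leP n m (A B : stoch R n m) e :
  KLmax A B <= e <-> forall u, KL (A u) (B u) <= e.
Proof.
split=> [Ae u|Ae]; first exact/(le_trans _ Ae)/(le_bigmax -oo (fun u => KL (A u) (B u))).
by apply/bigmax_leP; rewrite leNye.
Qed.

Lemma KL_le_KLmax n m (A B : stoch R n m) u : KL (A u) (B u) <= KLmax A B.
Proof. by move: u; exact/KLmax_leP. Qed.

(** The default [-oo] of the maximum never shows, because there is at least one input, such as the
    all-false one. *)
Lemma KLmax_ge0 n m (A B : stoch R n m) : 0 <= KLmax A B.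
Proof. exact: le_trans (KL_ge0 _ _) (KL_le_KLmax _ _ [tuple of nseq n false]). Qed.

Lemma KLmax_comp n m k (A A' : stoch R n m) (B B' : stoch R m k) :
  KLmax (stoch_comp A B) (stoch_comp A' B') <= KLmax A A' + KLmax B B'.
Proof.
apply/KLmax_leP => u; rewrite !ffunE.
apply: le_trans (KL_bind _ _ (KL_le_KLmax B B')) _.
by apply: leeD2r; exact: KL_le_KLmax.
Qed.

End Divergence.

(** * Monad laws for distributions and sums over concatenated bits *)

Section Kleisli.
Context {R : realType}.
Local Open Scope ring_scope.

Lemma bind_dirac (T U : finType) (x : T) (k : T -> dist R U) :
  bind (dirac x) k = k x.
Proof.
apply: dist_ext => y; rewrite ffunE (bigD1 x) //= ffunE eqxx mul1r.
by rewrite big1 ?addr0// => z /negPf zx; rewrite ffunE zx mul0r.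
Qed.

Lemma bind_ret (T : finType) (mu : dist R T) : bind mu (dirac (T:=T)) = mu.
Proof.
apply: dist_ext => y; rewrite ffunE (bigD1 y) //= ffunE eqxx mulr1.
by rewrite big1 ?addr0// => z; rewrite eq_sym ffunE => /negPf ->; rewrite mulr0.
Qed.

Lemma bind_cst (T U : finType) (mu : dist R T) (nu : dist R U) :
  bind mu (fun=> nu) = nu.
Proof. by apply: dist_ext => y; rewrite ffunE -big_distrl /= dist_sum1 mul1r. Qed.

Lemma bindA (T U V : finType) (mu : dist R T) (k : T -> dist R U)
    (l : U -> dist R V) :
  bind (bind mu k) l = bind mu (fun x => bind (k x) l).
Proof.
apply: dist_ext => y; rewrite !ffunE.
under eq_bigr do rewrite ffunE big_distrl /=.
rewrite exchange_big /=; apply: eq_bigr => x _.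
by rewrite ffunE big_distrr /=; apply: eq_bigr => z _; rewrite mulrA.
Qed.

Lemma eq_bind (T U : finType) (mu : dist R T) (k l : T -> dist R U) :
  k =1 l -> bind mu k = bind mu l.
Proof.
by move=> kl; apply: dist_ext => y; rewrite !ffunE; apply: eq_bigr => x _; rewrite kl.
Qed.

Lemma big_bcat (V : nmodType) n m (f : bits (n + m) -> V) :
  \sum_w f w = \sum_u \sum_v f (bcat u v).
Proof.
rewrite pair_bigA /= (reindex (fun p => bcat p.1 p.2)) //=.
exists (fun w => (bfst w, bsnd w)) => [[u v] _|w _] /=.
  by rewrite bfst_cat bsnd_cat.
by rewrite bcatK.
Qed.

Lemma big_bits1 (V : nmodType) (f : bits 1 -> V) :
  \sum_w f w = f [tuple true] + f [tuple false].
Proof.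
rewrite (bigD1 [tuple true]) //= (bigD1 [tuple false]) //= big1 ?addr0//.
by move=> w; case/tupleP: w => x w; rewrite (tuple0 w); case: x.
Qed.

Lemma bind_kron n m (U : finType) (mu : dist R (bits n)) (nu : dist R (bits m))
    (k : bits (n + m) -> dist R U) :
  bind (kron mu nu) k = bind mu (fun u => bind nu (fun v => k (bcat u v))).
Proof.
apply: dist_ext => y; rewrite !ffunE big_bcat; apply: eq_bigr => u _.
rewrite ffunE big_distrr /=; apply: eq_bigr => v _.
by rewrite ffunE bfst_cat bsnd_cat mulrA.
Qed.

Lemma kron_dirac n m (u : bits n) (v : bits m) :
  kron (dirac u) (dirac v) = dirac (bcat u v) :> dist R _.
Proof. by rewrite -[kron _ _]bind_ret bind_kron !bind_dirac. Qed.

Lemma bind_bernoulli (p : {i01 R}) (U : finType) (k : bits 1 -> dist R U) y :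
  bind (bernoulli p) k y =
  p%:num * k [tuple true] y + (1 - p%:num) * k [tuple false] y.
Proof. by rewrite ffunE big_bits1 !ffunE -!val_eqE /= !mulr1 !mulr0 addr0 add0r. Qed.

(** Provides conditional distributions. When the total mass is 0, [f] vanishes and any distribution
    serves; the one taken is [dirac x0]. *)
Lemma normalize (T : finType) (x0 : T) (f : T -> R) : (forall x, 0 <= f x) ->
  exists mu : dist R T, forall x, f x = (\sum_y f y) * mu x.
Proof.
move=> f0; have [s0|s0] := eqVneq (\sum_y f y) 0.
  by exists (dirac x0) => x; rewrite s0 mul0r; apply: (psumr_eq0P _ s0).
have P : [forall x, 0 <= [ffun x => f x / \sum_y f y] x] &&
         (\sum_x [ffun x => f x / \sum_y f y] x == 1).
  apply/andP; split.
    by apply/forallP => x; rewrite ffunE divr_ge0// sumr_ge0.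
  by under eq_bigr do rewrite ffunE; rewrite -big_distrl /= divff.
by exists (Dist P) => x; rewrite /= ffunE mulrC divfK.
Qed.

End Kleisli.

(** * Decomposition along the first bit, and exact chain rules *)

(* The distribution of [D_p(f_1, f_0)]. *)
Section Mixture.
Context {R : realType}.
Local Open Scope ring_scope.

Definition mixture m (p : {i01 R}) (mu1 mu0 : dist R (bits m)) :
    dist R (bits (1 + m)) :=
  bind (bernoulli p) (fun b =>
    bind (if thead b then mu1 else mu0) (fun v => dirac (bcat b v))).

Lemma mixtureE m (p : {i01 R}) (mu1 mu0 : dist R (bits m)) b v :
  mixture p mu1 mu0 (bcat [tuple b] v) =
  if b then p%:num * mu1 v else (1 - p%:num) * mu0 v.
Proof.
(* The first bit records the branch taken, so the branch [c != b] puts no mass on outcomes starting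
   with [b]. *)
have bE (mu : dist R (bits m)) (c : bool) :
    bind mu (fun v => dirac (bcat [tuple c] v)) (bcat [tuple b] v) =
    (c == b)%:R * mu v.
  rewrite ffunE (bigD1 v) //= ffunE eqE /= eqseq_cons eqxx andbT.
  rewrite big1 ?addr0 => [|w wv]; first by rewrite mulrC eq_sym.
  rewrite ffunE eqE /= eqseq_cons [(v == w :> seq bool)]eq_sym.
  by rewrite -[(w == v :> seq bool)]/(w == v) (negPf wv) andbF mulr0.
rewrite bind_bernoulli /= !bE.
by case: b {bE}; rewrite /= !mul1r !mul0r mulr0 ?addr0 ?add0r.
Qed.

(** Disintegration along the first bit: [p] is the probability that it is true, and [mu1], [mu0] are
    the conditional laws of the remaining bits, arbitrary when the condition has probability 0. *)
Lemma mixture_surj m (mu : dist R (bits (1 + m))) :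
  exists p mu1 mu0, mu = mixture p mu1 mu0.
Proof.
pose f b v := mu (bcat [tuple b] v).
have f0 b v : 0 <= f b v by exact: dist_ge0.
have s1 : \sum_v f true v + \sum_v f false v = 1.
  by rewrite -(dist_sum1 mu) big_bcat big_bits1.
have p0 : 0 <= \sum_v f true v by exact: sumr_ge0.
have p1 : \sum_v f true v <= 1 by rewrite -s1 lerDl sumr_ge0.
pose v0 : bits m := [tuple of nseq m false].
have [mu1 mu1E] := normalize v0 (f0 true).
have [mu0 mu0E] := normalize v0 (f0 false).
exists (Itv01 p0 p1), mu1, mu0; apply: dist_ext => w.
rewrite -(bcatK w); move: (bsnd w) => v; case/tupleP: (bfst w) => b w0.
have q : 1 - \sum_v f true v = \sum_v f false v.
  by rewrite -s1 addrAC subrr add0r.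
rewrite (tuple0 w0) mixtureE -/(f b v) /= q.
by case: b; rewrite [LHS](mu1E, mu0E).
Qed.

(** An equality and not just a bound: the first bit reveals the branch, so the sum splits into two
    disjoint scaled copies, each computed by [sum_kl_summandM]. *)
Lemma KL_mixture m (p q : {i01 R}) (mu1 mu0 nu1 nu0 : dist R (bits m)) :
  (KL (mixture p mu1 mu0) (mixture q nu1 nu0) =
   kl p q + p%:num%:E * KL mu1 nu1 + (1 - p%:num)%:E * KL mu0 nu0)%E.
Proof.
rewrite /KL big_bcat big_bits1 /=.
under eq_bigr do rewrite !mixtureE.
under [X in (_ + X)%E]eq_bigr do rewrite !mixtureE.
rewrite !sum_kl_summandM ?subr_ge0// /kl -!addeA; congr (_ + _)%E.
by rewrite addeCA.
Qed.

Lemma KL_kron n m (mu nu : dist R (bits n)) (mu' nu' : dist R (bits m)) :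
  (KL (kron mu mu') (kron nu nu') = KL mu nu + KL mu' nu')%E.
Proof.
rewrite {1}/KL big_bcat.
under eq_bigr => u _ do under eq_bigr do rewrite !ffunE bfst_cat bsnd_cat.
under eq_bigr do rewrite sum_kl_summandM ?dist_ge0//.
rewrite big_split /= -ge0_sume_distrl => [|u _]; last by rewrite lee_fin dist_ge0.
by rewrite sumEFin dist_sum1 mul1e.
Qed.

End Mixture.

(** * Interpretation of conditionals and of [branch] *)

Section Universality.
Context {R : realType} (if_ : forall n, term R (1 + n + n) n).
Hypothesis interp_if : forall n (x : bool) (u v : bits n),
  interp (if_ n) (bcat (bcat [tuple x] u) v) = dirac (if x then u else v).

Lemma interp_tens n m n' m' (f : term R n m) (g : term R n' m') u v :
  interp (Tens f g) (bcat u v) = kron (interp f u) (interp g v).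
Proof. by rewrite /= ffunE bfst_cat bsnd_cat. Qed.

Lemma interp_comp n m k (f : term R n m) (g : term R m k) u :
  interp (Comp f g) u = bind (interp f u) (interp g).
Proof. by rewrite /= ffunE. Qed.

Lemma interp_id n u : interp (Id n) u = dirac u :> dist R _.
Proof. by rewrite ffunE. Qed.

Lemma bcat_thead n (w : bits (1 + n)) : exists x u, w = bcat [tuple x] u.
Proof. by case/tupleP: w => x u; exists x, u; apply: val_inj. Qed.

(** Both branches are run; the outcome of the unselected one is ignored, and summing it out by
    [bind_cst] contributes a factor 1. *)
Lemma interp_ifthenelse n n' m (f1 : term R n m) (f0 : term R n' m) x u v :
  interp (ifthenelse if_ f1 f0) (bcat (bcat [tuple x] u) v) =
  if x then interp f1 u else interp f0 v.
Proof.
rewrite interp_comp !interp_tens interp_id !bind_kron bind_dirac.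
under eq_bind => u' do under eq_bind => v' do rewrite interp_if.
case: x; last by rewrite bind_cst bind_ret.
by under eq_bind => u' do rewrite bind_cst; rewrite bind_ret.
Qed.

Lemma interp_branch (p : {i01 R}) m (f1 f0 : term R 0 m) u :
  interp (branch if_ p f1 f0) u =
  mixture p (interp f1 [tuple]) (interp f0 [tuple]).
Proof.
rewrite /branch !interp_comp bindA.
have -> : interp (Tens (Tens (Flip p) f1) f0) u =
    kron (kron (bernoulli p) (interp f1 [tuple])) (interp f0 [tuple]).
  by rewrite /= !ffunE; congr (kron (kron _ (interp f1 _)) (interp f0 _)); exact: tuple0.
rewrite !bind_kron; apply: eq_bind => b.
(* Once the coin [b] and the outcomes [u'], [v'] are fixed, the rest is deterministic: one copy of
   the coin is output, the other selects the branch. *)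
have step u' v' : bind (interp (Tens (Tens Copy (Id m)) (Id m)) (bcat (bcat b u') v'))
    (interp (Tens (Id 1) (if_ m))) =
    dirac (bcat b (if thead b then u' else v')) :> dist R _.
  rewrite !interp_tens !interp_id /= ffunE !kron_dirac bind_dirac.
  (* Regroups the bits so that the second copy of the coin becomes the first input of [if_ m]. The
     two lengths are convertible, the two tuples only provably equal. *)
  have -> : bcat (bcat [tuple thead b; thead b] u') v' =
            bcat b (bcat (bcat [tuple thead b] u') v') :> bits (1 + (1 + m + m)).
    by apply: val_inj; case/tupleP: b => x b; rewrite (tuple0 b).
  apply: etrans (interp_tens (Id 1) (if_ m) b (bcat (bcat [tuple thead b] u') v')) _.
  by rewrite interp_if interp_id kron_dirac.
under eq_bind => u' do under eq_bind => v' do rewrite step.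
case: (thead b); last by rewrite bind_cst.
by under eq_bind => u' do rewrite bind_cst.
Qed.

(** * Deterministic wiring: duplicating a block of bits *)

(* Stated on underlying sequences, [computes] is insensitive to casts between
   provably equal arities. *)
Definition computes n m (f : term R n m) (h : seq bool -> seq bool) :=
  forall u : bits n, exists2 v : bits m, interp f u = dirac v & val v = h (val u).

Lemma computes_castt n n' m m' (en : n = n') (em : m = m') (f : term R n m) h :
  computes f h -> computes (castt en em f) h.
Proof. by case: _ / en; case: _ / em. Qed.

Lemma computes_comp n m k (f : term R n m) (g : term R m k) h h' :
  computes f h -> computes g h' -> computes (Comp f g) (h' \o h).
Proof.
move=> fh gh u; have [v fv vE] := fh u; have [w gw wE] := gh v.
by exists w; rewrite ?interp_comp ?fv ?bind_dirac// wE vE.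
Qed.

Lemma computes_tens n m n' m' (f : term R n m) (g : term R n' m') h h' :
  computes f h -> computes g h' ->
  computes (Tens f g) (fun s => h (take n s) ++ h' (drop n s)).
Proof.
move=> fh gh w; rewrite -(bcatK w); move: (bfst w) (bsnd w) => u u' {w}.
have [v fv vE] := fh u; have [v' gv vE'] := gh u'.
exists (bcat v v'); first by rewrite interp_tens fv gv kron_dirac.
by rewrite /= take_size_cat ?drop_size_cat ?size_tuple//= vE vE'.
Qed.

Lemma computes_id n : computes (Id n) id.
Proof. by move=> u; exists u; rewrite ?interp_id. Qed.

Lemma computes_copy : computes Copy (fun s => s ++ s).
Proof.
move=> u; exists [tuple thead u; thead u]; first by rewrite ffunE.
by case/tupleP: u => x u; rewrite (tuple0 u).
Qed.

Lemma computes_sym n m : computes (Sym n m) (fun s => drop n s ++ take n s).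
Proof.
move=> w; rewrite -(bcatK w); move: (bfst w) (bsnd w) => u v {w}.
exists (bcat v u); first by rewrite ffunE bfst_cat bsnd_cat.
by rewrite /= take_size_cat ?drop_size_cat ?size_tuple.
Qed.

Lemma computes_eq n m (f : term R n m) (h h' : seq bool -> seq bool) :
  (forall u : bits n, h (val u) = h' (val u)) -> computes f h -> computes f h'.
Proof. by move=> hh fh u; have [v fv vE] := fh u; exists v; rewrite // vE. Qed.

(** Copying head and tail separately yields [x x u u]; swapping the middle [x] and [u] gives
    [x u x u]. *)
Lemma duplicate n : exists f : term R n (n + n), computes f (fun s => s ++ s).
Proof.
elim: n => [|n [f fE]].
  by exists (Id 0) => u; exists u; rewrite ?interp_id// (tuple0 u).
have e : 1 + (n + 1) + n = n.+1 + n.+1 by rewrite addn1 add1n addSnnS.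
exists (castt erefl e
  (Comp (Tens Copy f : term R (1 + n) (1 + (1 + n) + n))
        (Tens (Tens (Id 1) (Sym 1 n)) (Id n)))).
apply: computes_castt.
have cfE : computes (Tens Copy f : term R (1 + n) (1 + (1 + n) + n)) _ :=
  computes_tens computes_copy fE.
have symE := computes_tens (computes_tens (@computes_id 1) (@computes_sym 1 n))
  (@computes_id n).
have compE := computes_comp cfE symE.
apply: computes_eq compE => u.
case/tupleP: u => x u /=; rewrite !drop0 !take0 /=.
rewrite (take_size_cat _ (size_tuple u)) (drop_size_cat _ (size_tuple u)).
by rewrite drop0 take0 -catA.
Qed.

Lemma duplicate_tail n : exists f : term R (1 + n) (1 + n + n),
  forall x u, interp f (bcat [tuple x] u) = dirac (bcat (bcat [tuple x] u) u).
Proof.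
have [f fE] := duplicate n.
exists (castt erefl (addnA 1 n n) (Tens (Id 1) f)) => x u.
have /(computes_castt erefl (addnA 1 n n)) := computes_tens (@computes_id 1) fE.
move=> /(_ (bcat [tuple x] u)) [v -> vE]; congr dirac; apply: val_inj.
by rewrite vE /= take0 drop0.
Qed.

(** The two branches of [ifthenelse] read separate inputs; duplicating the tail feeds both the same
    one. The term [c] is chosen before [f1] and [f0], so two conditionals can share it. *)
Lemma case_split n : exists c : term R (1 + n) (1 + n + n),
  forall m (f1 f0 : term R n m) x u,
  interp (Comp c (ifthenelse if_ f1 f0)) (bcat [tuple x] u) =
  if x then interp f1 u else interp f0 u.
Proof.
have [c cE] := duplicate_tail n; exists c => m f1 f0 x u.
by rewrite interp_comp cE bind_dirac interp_ifthenelse.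
Qed.

(** * Every stochastic matrix is the interpretation of a term *)

Lemma dist_bits0 (mu nu : dist R (bits 0)) : mu = nu.
Proof.
have one (xi : dist R (bits 0)) x : xi x = 1%R.
  by rewrite -(dist_sum1 xi) (bigD1 x) //= big1 ?addr0// => y; rewrite (tuple0 x) (tuple0 y).
by apply: dist_ext => x; rewrite !one.
Qed.

(** Inputs are stripped first, by conditionals; once none is left, outputs are stripped by
    disintegration. *)
Lemma interp_surj n m (A : stoch R n m) : exists f : term R n m, interp f = A.
Proof.
elim: n A => [|n IHn] A.
  elim: m A => [|m IHm] A.
    by exists (Id 0); apply/ffunP => u; exact: dist_bits0.
  have [p [mu1 [mu0 AE]]] := mixture_surj (A [tuple]).
  have [f1 f1E] := IHm [ffun=> mu1]; have [f0 f0E] := IHm [ffun=> mu0].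
  exists (branch if_ p f1 f0); apply/ffunP => u.
  by rewrite interp_branch f1E f0E !ffunE (tuple0 u) AE.
have [f1 f1E] := IHn [ffun u => A (bcat [tuple true] u)].
have [f0 f0E] := IHn [ffun u => A (bcat [tuple false] u)].
have [c cE] := case_split n; exists (Comp c (ifthenelse if_ f1 f0)).
apply/ffunP => w; have [x [u ->]] := bcat_thead w.
by rewrite cE f1E f0E !ffunE; case: x.
Qed.

End Universality.

(** * Soundness and completeness of the distance rules *)

Section Distance.
Context {R : realType} (TCirc : equations R).
Hypothesis TCirc_sound_complete : forall n m (f g : term R n m),
  eq_deriv TCirc f g <-> interp f = interp g.
Context (if_ : forall n, term R (1 + n + n) n).
Hypothesis interp_if : forall n (x : bool) (u v : bits n),
  interp (if_ n) (bcat (bcat [tuple x] u) v) = dirac (if x then u else v).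
Local Open Scope ereal_scope.

(** Induction on derivations, each rule matching one property of the divergence; for continuity, a
    lower bound of all [e i] is below their infimum. *)
Lemma q_deriv_sound n m (f g : term R n m) e :
  q_deriv TCirc if_ f g e -> KLmax (interp f) (interp g) <= e.
Proof.
elim=> {n m f g e}.
- by move=> n m f; apply/KLmax_leP => u; rewrite KLxx.
- move=> m f1 g1 f0 g0 p q e d _ _ _ /KLmax_leP le1 _ /KLmax_leP le0.
  apply/KLmax_leP => u; rewrite !(interp_branch interp_if) KL_mixture.
  by rewrite leeD ?leeD// lee_wpmul2l// ?lee_fin// subr_ge0.
- move=> n n' m f1 g1 f0 g0 e d _ _ _ /KLmax_leP le1 _ /KLmax_leP le0.
  apply/KLmax_leP => w; rewrite -(bcatK w); move: (bfst w) (bsnd w) => xu v.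
  have [x [u ->]] := bcat_thead xu.
  (* A fixed input selects the same branch on both sides, so a single one of the two bounds
     applies. *)
  by rewrite !(interp_ifthenelse interp_if) le_max; case: x; rewrite ?le1 ?le0 ?orbT.
- by move=> n m f f' g g' e /TCirc_sound_complete <- /TCirc_sound_complete <-.
- by move=> n m f g e e' _ ee' _ /le_trans; exact.
- by move=> n m f g I e _ _ le_e; apply/ereal_infP => _ [i _ <-].
- move=> n m k f f' g g' e d _ _ _ le_e _ le_d.
  exact: le_trans (KLmax_comp _ _ _ _) (leeD le_e le_d).
- move=> n m n' m' f f' g g' e d _ _ _ /KLmax_leP le_e _ /KLmax_leP le_d.
  apply/KLmax_leP => w; rewrite -(bcatK w) !interp_tens KL_kron.
  exact: leeD.
Qed.

(** The infimum defining the distance is thus attained. The recursion is that of [interp_surj], run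
    on both terms at once. *)
Lemma q_deriv_complete n m (f g : term R n m) :
  q_deriv TCirc if_ f g (KLmax (interp f) (interp g)).
Proof.
(* Completeness for equations lets any term be exchanged for another with the same matrix, in
   particular for one in the shape that a rule requires. *)
have replace k l (f1 f2 g1 g2 : term R k l) e : interp f1 = interp f2 ->
    interp g1 = interp g2 -> q_deriv TCirc if_ f1 g1 e -> q_deriv TCirc if_ f2 g2 e.
  by move=> /TCirc_sound_complete f12 /TCirc_sound_complete; exact: q_replace.
elim: n f g => [|n IHn] f g.
  elim: m f g => [|m IHm] f g.
    apply: (@q_mono _ _ _ _ _ _ _ 0) => //; first exact: KLmax_ge0.
    apply: (replace _ _ f f f g) => //; last exact: q_refl.
    by apply/ffunP => u; exact: dist_bits0.
  have [p [mu1 [mu0 fE]]] := mixture_surj (interp f [tuple]).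
  have [q [nu1 [nu0 gE]]] := mixture_surj (interp g [tuple]).
  have [f1 f1E] := interp_surj interp_if [ffun _ : bits 0 => mu1].
  have [f0 f0E] := interp_surj interp_if [ffun _ : bits 0 => mu0].
  have [g1 g1E] := interp_surj interp_if [ffun _ : bits 0 => nu1].
  have [g0 g0E] := interp_surj interp_if [ffun _ : bits 0 => nu0].
  have branchf : interp (branch if_ p f1 f0) = interp f.
    apply/ffunP => u.
    by rewrite (interp_branch interp_if) f1E f0E !ffunE (tuple0 u) fE.
  have branchg : interp (branch if_ q g1 g0) = interp g.
    apply/ffunP => u.
    by rewrite (interp_branch interp_if) g1E g0E !ffunE (tuple0 u) gE.
  apply: (replace _ _ _ _ _ _ _ branchf branchg).
  have le_KLmax0 k (A B : stoch R 0 k) : KLmax A B <= KL (A [tuple]) (B [tuple]).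
    by apply/KLmax_leP => u; rewrite (tuple0 u).
  (* The bound inferred here is the right-hand side of [KL_mixture], hence the divergence of [f] and
     [g] at their only input. *)
  have := q_chain p q (KLmax_ge0 _ _) (KLmax_ge0 _ _) (IHm f1 g1) (IHm f0 g0).
  apply: q_mono.
    apply: adde_ge0; first apply: adde_ge0; first exact: kl_ge0.
      by apply: mule_ge0; [rewrite lee_fin|exact: KLmax_ge0].
    by apply: mule_ge0; [rewrite lee_fin subr_ge0|exact: KLmax_ge0].
  apply: le_trans _ (KL_le_KLmax _ _ [tuple]).
  rewrite fE gE KL_mixture.
  have := le_KLmax0 _ (interp f1) (interp g1); rewrite f1E g1E !ffunE => le1.
  have := le_KLmax0 _ (interp f0) (interp g0); rewrite f0E g0E !ffunE => le0.
  by rewrite leeD ?leeD// lee_wpmul2l// ?lee_fin// subr_ge0.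
have restr (h : term R n.+1 m) : exists h1 h0 : term R n m,
    forall x u, interp h (bcat [tuple x] u) = if x then interp h1 u else interp h0 u.
  have [h1 h1E] := interp_surj interp_if [ffun u : bits n => interp h (bcat [tuple true] u)].
  have [h0 h0E] := interp_surj interp_if [ffun u : bits n => interp h (bcat [tuple false] u)].
  by exists h1, h0 => x u; rewrite h1E h0E !ffunE; case: x.
have [f1 [f0 fE]] := restr f; have [g1 [g0 gE]] := restr g.
have [c cE] := case_split interp_if n.
have splitE h h1 h0 :
    (forall x u, interp h (bcat [tuple x] u) = if x then interp h1 u else interp h0 u) ->
    interp (Comp c (ifthenelse if_ h1 h0)) = interp h :> stoch R (1 + n) m.
  by move=> hE; apply/ffunP => w; have [x [u ->]] := bcat_thead w; rewrite cE hE.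
apply: (replace _ _ _ _ _ _ _ (splitE _ _ _ fE) (splitE _ _ _ gE)).
have max0 := KLmax_ge0 (interp f1) (interp g1).
have fgmax := q_ifmax (KLmax_ge0 _ _) (KLmax_ge0 _ _) (IHn f1 g1) (IHn f0 g0).
(* The same [c] precedes both conditionals, so composing with it costs 0. *)
have := q_comp (lexx 0) _ (q_refl TCirc if_ c) fgmax; rewrite add0e le_max max0.
move=> /(_ isT); apply: q_mono; first by rewrite le_max max0.
(* The divergences of either restriction are among those of [f] and [g], at inputs with the
   corresponding first bit. *)
rewrite ge_max; apply/andP; split; apply/KLmax_leP => u.
  by have := KL_le_KLmax (interp f) (interp g) (bcat [tuple true] u); rewrite fE gE.
by have := KL_le_KLmax (interp f) (interp g) (bcat [tuple false] u); rewrite fE gE.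
Qed.

Lemma dKL_KLmax n m (f g : term R n m) :
  dKL TCirc if_ f g = KLmax (interp f) (interp g).
Proof.
apply/le_anti/andP; split.
  by apply: ereal_inf_lbound; split; [exact: KLmax_ge0|exact: q_deriv_complete].
by apply/ereal_infP => e [_]; exact: q_deriv_sound.
Qed.

End Distance.

(** * Passage to the quotient by provable equality *)

Theorem theorem4p4 (R : realType)
    (TCirc : equations R)
    (TCirc_sound_complete : forall (n m : nat) (f g : term R n m),
       eq_deriv TCirc f g <-> interp f = interp g)
    (if_ : forall n : nat, term R (1 + n + n) n)
    (interp_if : forall (n : nat) (x : bool) (u v : bits n),
       interp (if_ n) (bcat (bcat [tuple x] u) v)
       = dirac (if x then u else v))
    (n m : nat) :
  exists F : Syn TCirc n m -> stoch R n m,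
    [/\ forall f : term R n m, F (syn_class TCirc f) = interp f,
        bijective F
      & forall f g : term R n m,
          dKL TCirc if_ f g = KLmax (interp f) (interp g)].
Proof.
pose F (c : Syn TCirc n m) : stoch R n m := interp (repr c).
(* Independence of the representative is soundness for equations. *)
have FE f : F (syn_class TCirc f) = interp f.
  apply/TCirc_sound_complete.
  have /eqmodP : (repr (syn_class TCirc f) = f %[mod Syn TCirc n m])%qT := reprK _.
  by move=> /asboolP.
exists F; split => //; last by move=> f g; exact: dKL_KLmax.
(* The inverse picks a term denoting [A]; completeness for equations makes its class unique. *)
pose G A : Syn TCirc n m := syn_class TCirc (projT1 (cid (interp_surj interp_if A))).
exists G => [c|A]; last by rewrite /G FE; case: cid.
rewrite /G; case: cid => f /= fE; rewrite -(reprK c).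
by apply/eqmodP/asboolP/TCirc_sound_complete.
Qed.
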